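(* Let $X$ be a Banach space in which $C([0,1]^d)$ is continuously embedded, let $\sigma$ be $\mathrm{ReLU}$ or a Lipschitz sigmoidal function, and let $\mathcal N_{\xi,\sigma}(w)\subset X$ be the compact (possibly empty) set of all functions approximated in the norm of $X$ with accuracy $\xi_n$ by the outputs of deep networks of depth $n$ with activation function $\sigma$ and parameters bounded by $w(n)$. Let $C,C',c,c',\alpha,\delta>0$, $\nu\ge0$, $\beta\in\mathbb R$. - If $\xi=(\xi_n)$ with $\xi_n=C'[\log_2n]^\beta n^{-\alpha}$, then $$\epsilon_n(\mathcal N_{\xi,\sigma}(Cn^\delta))_X\lesssim n^{-\frac\alpha2}[\log_2n]^{\beta+\frac\alpha2},\quad n\in\mathbb N,$$ $$\epsilon_n(\mathcal N_{\xi,\sigma}(C2^{c'n^\nu}))_X\lesssim n^{-\frac{\alpha}{\nu+2}}[\log_2n]^{\beta},\quad n\in\mathbb N.$$ - If $\xi=(\xi_n)$ with $\xi_n=C'2^{-cn}$, then there is a constant $c_1>0$ such that $$\epsilon_n(\mathcal N_{\xi,\sigma}(Cn^\delta))_X\lesssim2^{-c_1\sqrt n/\sqrt{\log_2n}},\quad n\in\mathbb N,$$ and there is a constant $c_1>0$ such that $$\epsilon_n(\mathcal N_{\xi,\sigma}(C2^{c'n^\nu}))_X\lesssim2^{-c_1n^{1/(\nu+2)}},\quad n\in\mathbb N.$$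
   Context: Deep neural networks. Fix $d\ge1$, a width $W\geq 2$, and an activation function $\sigma:\mathbb R\to\mathbb R$ which is either $\mathrm{ReLU}(t)=\max\{0,t\}$ (then $L:=1$), or an $L$-Lipschitz sigmoidal function; the only properties of the latter that are used are $|\sigma(t)|\le 1$ and $|\sigma(t_1)-\sigma(t_2)|\le L|t_1-t_2|$ for all $t,t_1,t_2\in\mathbb R$. Let $\bar\sigma:\mathbb R^W\to\mathbb R^W$ be $\sigma$ applied coordinatewise. For depth $n\ge1$ consider affine mappings $A^{(0)}:\mathbb R^d\to\mathbb R^W$, $A^{(\ell)}:\mathbb R^W\to\mathbb R^W$ ($\ell=1,\dots,n-1$), $A^{(n)}:\mathbb R^W\to\mathbb R$; let $y\in\mathbb R^{\tilde n}$ list in a fixed order all entries of their matrices and offset vectors, $\tilde n=W(d+1)+(n-1)W(W+1)+W+1$. Define on $[0,1]^d$ the function $\Phi_\sigma(y):=A^{(n)}\circ\bar\sigma\circ A^{(n-1)}\circ\cdots\circ\bar\sigma\circ A^{(0)}$. The bound $w$ satisfies $w(n)\ge1$ and $LWw(n)\ge2$. Put $E(f,\Sigma_{n,\sigma}(w(n)))_X:=\inf_{\|y\|_{\ell_\infty^{\tilde n}}\le w(n)}\|f-\Phi_\sigma(y)\|_X$ for $n\ge1$ and $E(f,\Sigma_{0,\sigma}(w(0)))_X:=\|f\|_X$. Approximation class: for a sequence $\xi=(\xi_n)$ of non-negative numbers with $\inf_n\xi_n=0$, $$\mathcal N_{\xi,\sigma}(w):=\{f\in X: E(f,\Sigma_{n,\sigma}(w(n)))_X\le\xi_n\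 \forall n\ge0\}.$$ Where the formula $\xi_n=C'[\log_2n]^\beta n^{-\alpha}$ is used, it is for $n\ge2$, and $\xi_0,\xi_1$ are arbitrary fixed non-negative numbers. $\mathcal N_{\xi,\sigma}(Cn^\delta)$ means $\mathcal N_{\xi,\sigma}(w)$ with $w(n)=Cn^\delta$, and similarly for $C2^{c'n^\nu}$. Entropy numbers: $\epsilon_n(\mathcal K)_X$, $n\ge0$, is the infimum of all $\epsilon>0$ for which $\mathcal K$ is covered by $2^n$ balls of radius $\epsilon$ with centers in $X$. Asymptotic notation: for expressions $A,B$ depending on $n$, $A\lesssim B$ means that there is a constant $c>0$ independent of $n$ with $A\le cB$ as $n\to\infty$ (i.e. for all sufficiently large $n$, so that the logarithmic expressions are well defined). *)

(* Defs.v *)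
From HB Require Import structures.
From mathcomp Require Import all_boot all_order all_algebra.
From mathcomp Require Import all_classical all_reals all_analysis.
Set Implicit Arguments.
Unset Strict Implicit.
Unset Printing Implicit Defensive.
Import Order.TTheory GRing.Theory Num.Theory.
Import numFieldNormedType.Exports.
Local Open Scope classical_set_scope.
Local Open Scope ring_scope.

Section Activation.
Context {R : realType}.

Definition relu (t : R) : R := Num.max 0 t.

(* The limits at infinity of a sigmoidal function are deliberately not part of
   the definition: only boundedness by 1 and the Lipschitz condition matter, so
   every normalisation of these limits is covered. *)
Definition lipschitz_sigmoidal (L : R) (sigma : R -> R) : Prop :=
  (forall t, `|sigma t| <= 1) /\
  (forall t1 t2, `|sigma t1 - sigma t2| <= L * `|t1 - t2|).

Definition activation (L : R) (sigma : R -> R) : Prop :=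
  (sigma = relu /\ L = 1) \/ lipschitz_sigmoidal L sigma.

End Activation.

Section Networks.
Context {R : realType}.
Variables (d W : nat).

(* Number of parameters of a network of depth n >= 1. *)
Definition nparams (n : nat) : nat :=
  W * (d + 1) + (n.-1 * (W * (W + 1)) + (W + 1)).

(* The matrix and the offset vector of an affine map R^q -> R^p are stored
   together as a p x (q + 1) matrix whose last column is the offset. *)
Definition affine_map {p q : nat} (M : 'M[R]_(p, q + 1)) (x : 'cV[R]_q) :
  'cV[R]_p := lsubmx M *m x + rsubmx M.

(* The parameter vector y is the concatenation of the (row-major) entries of
   A^(0), then of A^(1), ..., A^(n-1), then of A^(n). *)
Section Layers.
Context {n : nat}.
Variable y : 'rV[R]_(nparams n).

Definition first_layer : 'M[R]_(W, d + 1) := vec_mx (lsubmx y).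

(* hidden_layer l is A^(l + 1). *)
Definition hidden_layer (l : 'I_n.-1) : 'M[R]_(W, W + 1) :=
  vec_mx (row l (vec_mx (lsubmx (rsubmx y)))).

Definition last_layer : 'M[R]_(1, W + 1) := rsubmx (rsubmx y).

End Layers.

Definition network (sigma : R -> R) (n : nat) (y : 'rV[R]_(nparams n))
    (x : 'cV[R]_d) : R :=
  let h := foldl (fun z l => map_mx sigma (affine_map (hidden_layer y l) z))
                 (map_mx sigma (affine_map (first_layer y) x))
                 (enum 'I_n.-1) in
  affine_map (last_layer y) h ord0 ord0.

End Networks.

Section Embedding.
Context {R : realType} {d : nat}.

Definition cube : set 'cV[R]_d := [set x | forall i, 0 <= x i ord0 <= 1].

(* An element of C([0,1]^d) is represented by any function on R^d whose
   restriction to the cube is continuous; only that restriction matters. *)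
Definition continuous_on_cube (f : 'cV[R]_d -> R) : Prop :=
  {within cube, continuous f}.

Definition sup_norm (f : 'cV[R]_d -> R) : R := sup [set `|f x| | x in cube].

(* The bound, with linearity, forces iota f to depend only on the restriction
   of f to the cube; iota is unconstrained outside C([0,1]^d). *)
Record continuous_embedding (X : normedModType R)
    (iota : ('cV[R]_d -> R) -> X) : Prop := ContinuousEmbedding {
  embedding_linear : forall (a : R) (f g : 'cV[R]_d -> R),
    continuous_on_cube f -> continuous_on_cube g ->
    iota (fun x => a * f x + g x) = a *: iota f + iota g ;
  embedding_injective : forall f g : 'cV[R]_d -> R,
    continuous_on_cube f -> continuous_on_cube g ->
    iota f = iota g -> forall x, cube x -> f x = g x ;
  embedding_bounded : exists K : R, forall f : 'cV[R]_d -> R,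
    continuous_on_cube f -> `|iota f| <= K * sup_norm f
}.

End Embedding.

Section Approximation.
Context {R : realType} {d : nat} {X : normedModType R}.
Variables (iota : ('cV[R]_d -> R) -> X) (W : nat) (sigma : R -> R).

(* The norm of a row vector is the maximum of the absolute values of its
   entries. *)
Definition approx_error (f : X) (n : nat) (b : R) : \bar R :=
  if n is 0%N then `|f|%:E
  else ereal_inf [set `|f - iota (network sigma y)|%:E
                 | y in [set y : 'rV[R]_(nparams d W n) | `|y| <= b]].

Definition approx_class (xi w : nat -> R) : set X :=
  [set f | forall n, (approx_error f n (w n) <= (xi n)%:E)%E].

End Approximation.

Definition admissible_bound {R : realType} (L : R) (W : nat) (w : nat -> R) :
    Prop :=
  forall n, (1 <= n)%N -> 1 <= w n /\ 2 <= L * W%:R * w n.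

(* The infimum is taken in the extended reals, so that it is +oo when there is
   no covering by 2 ^ n balls. *)
Definition entropy_number {R : realType} {X : normedModType R} (n : nat)
    (K : set X) : \bar R :=
  ereal_inf [set e%:E | e in [set e : R | 0 < e /\
    exists z : 'I_(2 ^ n) -> X, K `<=` \bigcup_i ball (z i) e]].

Definition log2 {R : realType} (t : R) : R := ln t / ln 2.

Definition asymp_le {R : realType} (A : nat -> \bar R) (B : nat -> R) : Prop :=
  exists2 k : R, 0 < k & \forall n \near \oo, (A n <= (k * B n)%:E)%E.

(* Main.v *)
(** Parameters bounded by [w] and inputs from the cube make the network map
    Lipschitz in the parameter vector (sup norm on the cube), with constant
    [(D w)^(n+1) (n+1)] up to a factor, by induction over the layers; only
    [|sigma t| <= max 1 |t|] and the Lipschitz property of [sigma] enter, which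
    treats ReLU and the sigmoidal case at once.  A dyadic grid of [2^(k N)]
    parameter vectors, with [N] of order [n] and [k] of order
    [n (1 + log w(n)) + log (1 / xi_n)], then yields balls of radius [3 xi_n]
    that cover the class.  This gives total boundedness, hence compactness, and
    [eps_m <= 3 xi_n] as soon as [m >= D n^2 g(n)], where [g] dominates
    [log w].  It remains to take [n] of order [t(m)], the inverse of
    [n^2 g(n)]: [t(m) = sqrt (m / log m)] for polynomial weights and
    [t(m) = m^(1/(nu+2))] for exponential ones. *)

Require Import Defs.
From HB Require Import structures.
From mathcomp Require Import all_boot all_order all_algebra.
From mathcomp Require Import all_classical all_reals all_analysis.
From mathcomp Require Import zify ring lra.
Set Implicit Arguments.
Unset Strict Implicit.
Unset Printing Implicit Defensive.
Import Order.TTheory GRing.Theory Num.Theory.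
Import numFieldNormedType.Exports.
Local Open Scope classical_set_scope.
Local Open Scope ring_scope.

(** * Activation functions and affine layers *)

(** The growth bound [Num.max 1 |t|] is the common weakening of [|relu t| <= |t|] and
    [|sigma t| <= 1]. The Lipschitz constant is raised to at least 1 so that powers of the layer
    factors are monotone. *)
Lemma activation_bounds (R : realType) (L : R) (sigma : R -> R) :
  activation L sigma ->
  exists2 L1 : R, 1 <= L1 &
    (forall t, `|sigma t| <= Num.max 1 `|t|) /\
    (forall s t, `|sigma s - sigma t| <= L1 * `|s - t|).
Proof.
case=> [[-> _]|[sigma1 sigmaL]].
  have reluE t : relu t = if 0 <= t then t else 0 :> R by rewrite /relu maxEle.
  exists 1 => //; split=> [t|s t].
    rewrite le_max reluE.
    by case: ifP => _; rewrite ?lexx ?orbT // normr0 ler01.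
  rewrite mul1r !reluE.
  case: (lerP 0 s) => s0; case: (lerP 0 t) => t0 //;
    rewrite ?subrr ?normr0 ?normr_ge0 //.
    by rewrite subr0 !ger0_norm; lra.
  by rewrite sub0r normrN ger0_norm // ler0_norm; lra.
exists (Num.max 1 L); first by rewrite le_max lexx.
split=> [t|s t]; first by rewrite le_max sigma1.
by apply: le_trans (sigmaL s t) _; rewrite ler_wpM2r // le_max lexx orbT.
Qed.

Lemma mx_norm_leP (R : realType) (m n : nat) (M : 'M[R]_(m, n)) (r : R) :
  0 <= r -> (`|M| <= r <-> forall i j, `|M i j| <= r).
Proof.
move=> r0; rewrite [`|M|]/Num.Def.normr /= mx_normrE; split=> [Mr i j|Mr].
  by apply: le_trans Mr; apply/bigmax_geP; right; exists (i, j).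
by apply/bigmax_leP; split=> // -[i j] _; apply: Mr.
Qed.

Lemma mx_entry_le (R : realType) (m n : nat) (M : 'M[R]_(m, n)) i j :
  `|M i j| <= `|M|.
Proof. exact: (iffLR (mx_norm_leP M (normr_ge0 M))). Qed.

(** Each output entry has [q] products and one offset; since [1 <= r], the offset is also at most
    [w * r]. *)
Lemma affine_map_norm (R : realType) (p q : nat) (M : 'M[R]_(p, q + 1))
    (x : 'cV[R]_q) (w r : R) :
  `|M| <= w -> `|x| <= r -> 1 <= r -> `|affine_map M x| <= q.+1%:R * w * r.
Proof.
move=> Mw xr r1.
have w0 : 0 <= w by apply: le_trans Mw.
have r0 : 0 <= r by apply: le_trans r1.
apply/mx_norm_leP => [|i j]; first by rewrite !mulr_ge0.
rewrite !mxE; apply: le_trans (ler_normD _ _) _.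
rewrite -natr1 !mulrDl mul1r; apply: lerD; last first.
  apply: le_trans (mx_entry_le _ _ _) _; apply: le_trans Mw _.
  by rewrite ler_peMr.
apply: le_trans (ler_norm_sum _ _ _) _.
rewrite -mulrA mulr_natl -[X in _ *+ X]card_ord -sumr_const.
apply: ler_sum => k _; rewrite mxE normrM; apply: ler_pM => //.
  exact: le_trans (mx_entry_le _ _ _) Mw.
exact: le_trans (mx_entry_le _ _ _) xr.
Qed.

(** The linear parts differ by [M (x - y) + (M - N) y], so a bound on one matrix and on one vector
    is enough; the offset difference is at most [a <= r * a]. *)
Lemma affine_map_dist (R : realType) (p q : nat) (M N : 'M[R]_(p, q + 1))
    (x y : 'cV[R]_q) (w r e a : R) :
  `|M| <= w -> `|y| <= r -> 1 <= r -> `|x - y| <= e -> `|M - N| <= a ->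
  `|affine_map M x - affine_map N y| <= q.+1%:R * (w * e + r * a).
Proof.
move=> Mw yr r1 xye MNa.
have w0 : 0 <= w by apply: le_trans Mw.
have a0 : 0 <= a by apply: le_trans MNa.
have e0 : 0 <= e by apply: le_trans xye.
have r0 : 0 <= r by apply: le_trans r1.
have we0 : 0 <= w * e + r * a by rewrite addr_ge0 ?mulr_ge0.
apply/mx_norm_leP => [|i j]; first by rewrite mulr_ge0.
rewrite !mxE [leLHS](_ : _ = `|\sum_k (M i (lshift 1 k) * (x - y) k j +
  (M - N) i (lshift 1 k) * y k j) + (M - N) i (rshift q j)|); last first.
  congr `|_|; rewrite opprD addrACA -sumrB; congr (_ + _); last by rewrite !mxE.
  by apply: eq_bigr => k _; rewrite !mxE; ring.
apply: le_trans (ler_normD _ _) _.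
rewrite -natr1 mulrDl mul1r; apply: lerD; last first.
  apply: le_trans (mx_entry_le _ _ _) _; apply: le_trans MNa _.
  by rewrite ler_wpDl ?mulr_ge0 // ler_peMl.
apply: le_trans (ler_norm_sum _ _ _) _.
rewrite mulr_natl -[X in _ *+ X]card_ord -sumr_const.
apply: ler_sum => k _; apply: le_trans (ler_normD _ _) _.
rewrite !normrM; apply: lerD.
  apply: ler_pM => //; first exact: le_trans (mx_entry_le _ _ _) Mw.
  exact: le_trans (mx_entry_le _ _ _) xye.
rewrite mulrC; apply: ler_pM => //.
  exact: le_trans (mx_entry_le _ _ _) yr.
exact: le_trans (mx_entry_le _ _ _) MNa.
Qed.

Lemma map_mx_activation_norm (R : realType) (sigma : R -> R) (m n : nat)
    (M : 'M[R]_(m, n)) (r : R) :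
  (forall t, `|sigma t| <= Num.max 1 `|t|) ->
  `|M| <= r -> 1 <= r -> `|map_mx sigma M| <= r.
Proof.
move=> sigma1 Mr r1; apply/mx_norm_leP => [|i j]; first exact: le_trans r1.
rewrite mxE; apply: le_trans (sigma1 _) _; rewrite ge_max r1 /=.
exact: le_trans (mx_entry_le _ _ _) Mr.
Qed.

Lemma map_mx_activation_dist (R : realType) (sigma : R -> R) (L : R)
    (m n : nat) (M N : 'M[R]_(m, n)) (e : R) :
  0 <= L -> (forall s t, `|sigma s - sigma t| <= L * `|s - t|) ->
  `|M - N| <= e -> `|map_mx sigma M - map_mx sigma N| <= L * e.
Proof.
move=> L0 sigmaL MNe.
have e0 : 0 <= e by apply: le_trans MNe.
apply/mx_norm_leP => [|i j]; first exact: mulr_ge0.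
rewrite !mxE; apply: le_trans (sigmaL _ _) _; rewrite ler_wpM2l //.
by have := mx_entry_le (M - N) i j; rewrite !mxE => /le_trans; apply.
Qed.

(** * Lipschitz dependence of a network on its parameters and its input *)

(** Extracting a layer only selects entries of [y], hence does not increase distances; the same
    holds for the hidden and the last layers. With [layers0] and [y' = 0] this also bounds each
    layer by [|y|]. *)
Lemma first_layerB (R : realType) (d W n : nat)
    (y y' : 'rV[R]_(nparams d W n)) :
  `|first_layer y - first_layer y'| <= `|y - y'|.
Proof.
apply/mx_norm_leP => // i j; rewrite !mxE.
by have := mx_entry_le (y - y') ord0 (lshift _ (mxvec_index i j)); rewrite !mxE.
Qed.

Lemma hidden_layerB (R : realType) (d W n : nat)
    (y y' : 'rV[R]_(nparams d W n)) l :
  `|hidden_layer y l - hidden_layer y' l| <= `|y - y'|.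
Proof.
apply/mx_norm_leP => // i j; rewrite !mxE.
have := mx_entry_le (y - y') ord0
  (rshift _ (lshift _ (mxvec_index l (mxvec_index i j)))).
by rewrite !mxE.
Qed.

Lemma last_layerB (R : realType) (d W n : nat)
    (y y' : 'rV[R]_(nparams d W n)) :
  `|last_layer y - last_layer y'| <= `|y - y'|.
Proof.
apply/mx_norm_leP => // i j; rewrite !mxE (ord1 i).
by have := mx_entry_le (y - y') ord0 (rshift _ (rshift _ j)); rewrite !mxE.
Qed.

Lemma layers0 (R : realType) (d W n : nat) :
  (first_layer (0 : 'rV[R]_(nparams d W n)) = 0) *
  (forall l, hidden_layer (0 : 'rV[R]_(nparams d W n)) l = 0) *
  (last_layer (0 : 'rV[R]_(nparams d W n)) = 0).
Proof.
do 2?[split] => [|l|]; apply/matrixP => i j; rewrite !mxE //.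
Qed.

Section NetworkLipschitz.
Variables (R : realType) (d W : nat) (sigma : R -> R) (L w : R).
Hypotheses (L1 : 1 <= L) (w1 : 1 <= w).
Hypothesis sigma1 : forall t, `|sigma t| <= Num.max 1 `|t|.
Hypothesis sigmaL : forall s t, `|sigma s - sigma t| <= L * `|s - t|.

(** One constant that dominates both [d + 1] and [W + 1], the numbers of terms in an entry of any
    layer. *)
Let A : R := (d + W).+1%:R.

Definition network_rate : R := L * (A * w).
Local Notation B := network_rate.

Let A1 : 1 <= A. Proof. by rewrite /A ler1n. Qed.

Let Aw1 : 1 <= A * w.
Proof. by apply: mulr_ege1. Qed.

Let AwB : A * w <= B.
Proof. by rewrite /B ler_peMl // (le_trans ler01). Qed.

Lemma network_rate_ge1 : 1 <= B.
Proof. exact: le_trans AwB. Qed.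

Let L0 : 0 <= L. Proof. exact: le_trans L1. Qed.
Let B0 : 0 <= B. Proof. exact: le_trans network_rate_ge1. Qed.

Let layer_norm (p q : nat) (M : 'M[R]_(p, q + 1)) (x : 'cV[R]_q) (r : R) :
  (q <= d + W)%N -> `|M| <= w -> `|x| <= r -> 1 <= r ->
  `|map_mx sigma (affine_map M x)| <= A * w * r.
Proof.
move=> qA Mw xr r1; apply: map_mx_activation_norm => //; last first.
  by apply: mulr_ege1.
apply: le_trans (affine_map_norm Mw xr r1) _.
by rewrite !ler_wpM2r ?(le_trans ler01) // ler_nat ltnS.
Qed.

Let affine_dist (p q : nat) (M N : 'M[R]_(p, q + 1)) (x y : 'cV[R]_q)
    (r e a : R) :
  (q <= d + W)%N -> `|M| <= w -> `|y| <= r -> 1 <= r ->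
  `|x - y| <= e -> `|M - N| <= a ->
  `|affine_map M x - affine_map N y| <= A * w * (e + r * a).
Proof.
move=> qA Mw yr r1 xye MNa.
have a0 : 0 <= a by apply: le_trans MNa.
have e0 : 0 <= e by apply: le_trans xye.
have r0 : 0 <= r by apply: le_trans r1.
have w0 : 0 <= w by apply: le_trans w1.
have ra0 : 0 <= r * a by rewrite mulr_ge0.
apply: le_trans (affine_map_dist Mw yr r1 xye MNa) _.
rewrite -mulrA; apply: ler_pM => //.
- by rewrite addr_ge0 ?mulr_ge0.
- by rewrite ler_nat ltnS.
- by rewrite mulrDr lerD2l ler_peMl.
Qed.

Let layer_dist (p q : nat) (M N : 'M[R]_(p, q + 1)) (x y : 'cV[R]_q)
    (r e a : R) :
  (q <= d + W)%N -> `|M| <= w -> `|y| <= r -> 1 <= r ->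
  `|x - y| <= e -> `|M - N| <= a ->
  `|map_mx sigma (affine_map M x) - map_mx sigma (affine_map N y)| <=
    B * (e + r * a).
Proof.
move=> qA Mw yr r1 xye MNa; rewrite /B -mulrA.
exact: map_mx_activation_dist (affine_dist qA Mw yr r1 xye MNa).
Qed.

(** Induction over an arbitrary list of layers, with the starting vectors general because [foldl]
    changes them. One layer replaces [r] by [A * w * r] and [e] by [B * (e + r * a)]; as
    [A * w <= B], the new errors add up to a factor linear in the number of layers. *)
Lemma hidden_layers_dist (n : nat) (y y' : 'rV[R]_(nparams d W n)) s
    (z z' : 'cV[R]_W) (r e a : R) :
  (forall l, `|hidden_layer y l| <= w) ->
  (forall l, `|hidden_layer y' l| <= w) ->
  (forall l, `|hidden_layer y l - hidden_layer y' l| <= a) ->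
  `|z'| <= r -> 1 <= r -> `|z - z'| <= e ->
  let h v u :=
    foldl (fun t l => map_mx sigma (affine_map (hidden_layer v l) t)) u s in
  `|h y' z'| <= (A * w) ^+ size s * r /\
  `|h y z - h y' z'| <= B ^+ size s * (e + (size s)%:R * r * a).
Proof.
move=> yw y'w yy'; elim: s z z' r e => [|l s IH] z z' r e z'r r1 zz' /=.
  by rewrite !expr0 !mul0r addr0 !mul1r.
have WA : (W <= d + W)%N by rewrite leq_addl.
have r0 : 0 <= r by apply: le_trans r1.
have a0 : 0 <= a by apply: le_trans (yy' l).
have [] := IH _ _ _ _ (layer_norm WA (y'w l) z'r r1) _
  (layer_dist WA (yw l) z'r r1 zz' (yy' l)).
  by apply: mulr_ege1.
move=> hr hd; split; first by rewrite exprSr -mulrA.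
apply: le_trans hd _; rewrite exprSr -[leRHS]mulrA ler_wpM2l ?exprn_ge0 //.
(* The surplus of the claimed bound over the inductive one is a nonnegative multiple of
   [B - A * w]. *)
rewrite -subr_ge0 -natr1.
have -> : B * (e + ((size s)%:R + 1) * r * a) -
    (B * (e + r * a) + (size s)%:R * (A * w * r) * a) =
  (size s)%:R * (r * a) * (B - A * w) by ring.
by rewrite !mulr_ge0 // subr_ge0.
Qed.

(** Both arguments vary: [y = y'] gives continuity on the cube, [x = x'] gives the dependence on the
    parameters. For [n >= 1] the exponent [n.-1.+2] is the number [n + 1] of affine maps. *)
Lemma network_dist (n : nat) (y y' : 'rV[R]_(nparams d W n)) x x' :
  `|y| <= w -> `|y'| <= w -> `|x'| <= 1 ->
  `|network sigma y x - network sigma y' x'| <=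
    B ^+ n.-1.+2 * (`|x - x'| + n.-1.+2%:R * `|y - y'|).
Proof.
move=> yw y'w x'1; set a := `|y - y'|; set e := `|x - x'|.
have dA : (d <= d + W)%N by rewrite leq_addr.
have WA : (W <= d + W)%N by rewrite leq_addl.
have a0 : 0 <= a by exact: normr_ge0.
have e0 : 0 <= e by exact: normr_ge0.
have A0 : 0 <= A by exact: le_trans A1.
have w0 : 0 <= w by exact: le_trans w1.
have Aw0 : 0 <= A * w by exact: mulr_ge0.
have ea0 : 0 <= e + a by exact: addr_ge0.
have fw (v : 'rV[R]_(nparams d W n)) : `|v| <= w -> `|first_layer v| <= w.
  by apply: le_trans; have := first_layerB v 0; rewrite layers0 !subr0.
have hw (v : 'rV[R]_(nparams d W n)) : `|v| <= w ->
    forall l, `|hidden_layer v l| <= w.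
  move=> vw l; apply: le_trans vw.
  by have := hidden_layerB v 0 l; rewrite layers0 !subr0.
have lw (v : 'rV[R]_(nparams d W n)) : `|v| <= w -> `|last_layer v| <= w.
  by apply: le_trans; have := last_layerB v 0; rewrite layers0 !subr0.
have r1 : 1 <= A * w * 1 by rewrite mulr1.
have [] := hidden_layers_dist (enum 'I_n.-1) (hw _ yw) (hw _ y'w)
  (hidden_layerB y y') (layer_norm dA (fw _ y'w) x'1 (lexx 1)) r1
  (layer_dist dA (fw _ yw) x'1 (lexx 1) (lexx e) (first_layerB y y')).
rewrite size_enum_ord mulr1 -exprSr mul1r -/a -/e => hr hd.
have hr1 : 1 <= (A * w) ^+ n.-1.+1 by rewrite exprn_ege1.
have hr' : (A * w) ^+ n.-1.+1 <= B ^+ n.-1.+1.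
  by apply: lerXn2r; rewrite ?nnegrE.
rewrite /network.
set z := foldl _ _ _ in hd *; set z' := foldl _ _ _ in hr hd *.
have := affine_dist WA (lw _ yw) hr hr1 hd (last_layerB y y').
move=> /(le_trans (mx_entry_le _ ord0 ord0)); rewrite 2!mxE [X in `|_ + X|]mxE.
move=> /le_trans; apply; rewrite -/a [in leRHS]exprS -[leRHS]mulrA.
apply: ler_pM => //.
  by rewrite addr_ge0 ?mulr_ge0 ?exprn_ge0 ?(addr_ge0 (mulr_ge0 _ ea0))
    ?mulr_ge0.
(* The surplus splits into two terms, nonnegative by [A * w <= B] and by the same inequality between
   powers. *)
rewrite -subr_ge0 exprSr -!natr1.
have -> : B ^+ n.-1 * B * (e + (n.-1%:R + 1 + 1) * a) -
    (B ^+ n.-1 * (B * (e + a) + n.-1%:R * (A * w) * a) +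
     (A * w) ^+ n.-1.+1 * a) =
  B ^+ n.-1 * (n.-1%:R * a * (B - A * w)) +
  (B ^+ n.-1.+1 - (A * w) ^+ n.-1.+1) * a by rewrite [B ^+ _.+1]exprSr; ring.
by rewrite addr_ge0 ?mulr_ge0 ?exprn_ge0 ?subr_ge0.
Qed.

End NetworkLipschitz.

(** * Passage from the cube to the space [X] *)

Lemma cube_norm (R : realType) (d : nat) (x : 'cV[R]_d) : cube x -> `|x| <= 1.
Proof.
move=> cx; apply/mx_norm_leP => // i j; rewrite (ord1 j).
by have /andP[x0 x1] := cx i; rewrite ger0_norm.
Qed.

Lemma lipschitz_continuous_on_cube (R : realType) (d : nat)
    (f : 'cV[R]_d -> R) (B : R) :
  (forall x y, cube x -> cube y -> `|f x - f y| <= B * `|x - y|) ->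
  continuous_on_cube f.
Proof.
move=> fB; apply/subspace_continuousP => x cx; apply/cvgrPdist_lt => e e0.
have B1 : 0 < `|B| + 1 by rewrite ltr_wpDl.
have eB : 0 < e / (`|B| + 1) by rewrite divr_gt0.
rewrite near_withinE; apply/nbhs_ballP; exists (e / (`|B| + 1)) => //= y.
rewrite -ball_normE /= ltr_pdivlMr // => xy cy.
apply: le_lt_trans (fB _ _ cx cy) (le_lt_trans _ xy).
by rewrite mulrC ler_wpM2l // (le_trans (ler_norm B)) // lerDl.
Qed.

(** Linearity is available for combinations [a * f + g] only, so the difference is written as
    [-1 * g + f]. The cube contains 0, hence the supremum is over a nonempty bounded set and is at
    most [e]. *)
Lemma embedding_dist (R : realType) (d : nat) (X : normedModType R)
    (iota : ('cV[R]_d -> R) -> X) :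
  continuous_embedding iota ->
  exists2 K : R, 1 <= K & forall f g (e : R),
    continuous_on_cube f -> continuous_on_cube g ->
    (forall x, cube x -> `|f x - g x| <= e) -> `|iota f - iota g| <= K * e.
Proof.
move=> [lin _ [K bd]]; exists (Num.max 1 K); first by rewrite le_max lexx.
move=> f g e cf cg fge.
have -> : iota f - iota g = iota (fun x => -1 * g x + f x).
  by rewrite lin // scaleN1r addrC.
have cube0 : cube (0 : 'cV[R]_d) by move=> i; rewrite mxE lexx ler01.
have dE x : -1 * g x + f x = f x - g x by rewrite mulN1r addrC.
have cfg : continuous_on_cube (fun x => -1 * g x + f x).
  by under eq_fun do rewrite dE; apply: within_continuousB.
have e0 : 0 <= e by apply: le_trans (fge _ cube0).
apply: le_trans (bd _ cfg) _.
have ubd : ubound [set `|-1 * g x + f x| | x in cube] e.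
  by move=> _ [x cx <-]; rewrite dE; apply: fge.
have ne : [set `|-1 * g x + f x| | x in cube] !=set0.
  by exists `|-1 * g 0 + f 0|; exists 0.
(* Nonnegativity allows [K] to be replaced by [Num.max 1 K]. *)
have s0 : 0 <= sup_norm (fun x => -1 * g x + f x).
  apply: le_trans (_ : `|-1 * g 0 + f 0| <= _) => //.
  by apply: ub_le_sup; [exists e | exists 0].
apply: le_trans (_ : Num.max 1 K * sup_norm (fun x => -1 * g x + f x) <= _).
  by rewrite ler_wpM2r // le_max lexx orbT.
by rewrite ler_wpM2l ?le_max ?ler01 //; apply: sup_le_ub.
Qed.

Lemma embedded_network_dist (R : realType) (d W : nat) (X : normedModType R)
    (iota : ('cV[R]_d -> R) -> X) (sigma : R -> R) (L : R) :
  continuous_embedding iota -> activation L sigma ->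
  exists2 D : R, 1 <= D & forall n w (y y' : 'rV[R]_(nparams d W n.+1)),
    1 <= w -> `|y| <= w -> `|y'| <= w ->
    `|iota (network sigma y) - iota (network sigma y')| <=
      D * ((D * w) ^+ n.+2 * (n.+2%:R * `|y - y'|)).
Proof.
move=> /embedding_dist[K K1 hK] /activation_bounds[L1 L11 [sigma1 sigmaL]].
set A : R := (d + W).+1%:R.
have A1 : 1 <= A by rewrite ler1n.
have LA1 : 1 <= L1 * A by apply: mulr_ege1.
have K0 : 0 <= K by apply: le_trans K1.
have cont n w (y : 'rV[R]_(nparams d W n.+1)) : 1 <= w -> `|y| <= w ->
    continuous_on_cube (network sigma y).
  move=> w1 yw; apply: lipschitz_continuous_on_cube => x x' _ /cube_norm x'1.
  (* With equal parameters only the input term remains, which gives continuity. *)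
  have := network_dist L11 w1 sigma1 sigmaL x yw yw x'1.
  by rewrite subrr normr0 mulr0 addr0; apply.
have D1 : 1 <= K * (L1 * A) by apply: mulr_ege1.
exists (K * (L1 * A)) => // n w y y' w1 yw y'w.
have w0 : 0 <= w by apply: le_trans w1.
apply: le_trans (hK _ _ _ (cont _ _ _ w1 yw) (cont _ _ _ w1 y'w) _) _.
  move=> x /cube_norm x1.
  have := network_dist L11 w1 sigma1 sigmaL x yw y'w x1.
  by rewrite subrr normr0 add0r; apply.
have LAw : 0 <= network_rate d W L1 w by rewrite !mulr_ge0 // (le_trans ler01).
apply: ler_pM => //; first by rewrite (mulr_ge0 (exprn_ge0 _ LAw)) ?mulr_ge0.
  by rewrite ler_peMr.
rewrite ler_wpM2r ?mulr_ge0 //; apply: lerXn2r; rewrite ?nnegrE //.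
  by rewrite mulr_ge0 // (le_trans ler01).
by rewrite /network_rate -!mulrA ler_peMl.
Qed.

(** * Parameter grids and coverings of the class *)

(** In each coordinate the grid is [j * h - w] with [j < 2 ^ k], and [y] is rounded down. The grid
    stays inside the box because the Lipschitz estimate requires both parameter vectors to be
    bounded by [w]. *)
Lemma box_grid (R : realType) (N k : nat) (w : R) : 0 < w ->
  exists F : {ffun 'I_N -> 'I_(2 ^ k)} -> 'rV[R]_N,
    (forall t, `|F t| <= w) /\
    (forall y, `|y| <= w -> exists t, `|y - F t| <= 2 * w / 2 ^+ k).
Proof.
move=> w0; have k0 : (0 < 2 ^ k)%N by rewrite expn_gt0.
set h : R := 2 * w / 2 ^+ k.
have h0 : 0 < h by rewrite divr_gt0 ?mulr_gt0 ?exprn_gt0.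
have hk : 2 ^+ k * h = 2 * w.
  by rewrite /h mulrC divfK // lt0r_neq0 ?exprn_gt0.
exists (fun t : {ffun 'I_N -> 'I_(2 ^ k)} => \row_i ((t i)%:R * h - w)).
split=> [t|y yw].
  apply/mx_norm_leP; first exact: ltW.
  move=> i j; rewrite mxE ler_norml.
  have tj0 : 0 <= (t j)%:R * h by rewrite mulr_ge0 // ltW.
  suff : (t j)%:R * h <= 2 * w by lra.
  by rewrite -hk ler_wpM2r ?(ltW h0) // -natrX ler_nat ltnW.
(* The cap matters when a coordinate equals [w]: the quotient is then [2 ^ k], one past the last
   index. *)
have cP i : (minn (Num.trunc ((y ord0 i + w) / h)) (2 ^ k).-1 < 2 ^ k)%N.
  by rewrite gtn_min ltn_predL k0 orbT.
exists [ffun i => Ordinal (cP i)]; apply/mx_norm_leP; first exact: ltW.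
move=> i j; rewrite !mxE (ord1 i) ffunE /=.
set c := Num.trunc _; set c' := minn _ _.
have /ler_normlP[yw1 yw2] := le_trans (mx_entry_le y ord0 j) yw.
have q0 : 0 <= (y ord0 j + w) / h by rewrite divr_ge0 ?(ltW h0) //; lra.
have /andP[cl cr] : c%:R <= (y ord0 j + w) / h < c.+1%:R by exact: truncn_itv.
rewrite ler_pdivlMr // in cl; rewrite ltr_pdivrMr // in cr.
have c'l : c'%:R * h <= y ord0 j + w.
  by apply: le_trans cl; rewrite ler_wpM2r ?(ltW h0) // ler_nat geq_minl.
have c'r : y ord0 j + w <= c'.+1%:R * h.
  rewrite /c'; case: leqP => _; first exact: ltW.
  by rewrite prednK // natrX hk; lra.
by rewrite -natr1 mulrDl mul1r in c'r; rewrite ler_norml; lra.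
Qed.

(** The infimum in [approx_error] need not be attained, hence the strict slack [xi n.+1 < e]. *)
Lemma approx_class_near_network (R : realType) (d W : nat)
    (X : normedModType R) (iota : ('cV[R]_d -> R) -> X) (sigma : R -> R)
    (xi w : nat -> R) (n : nat) (f : X) (e : R) :
  approx_class iota W sigma xi w f -> xi n.+1 < e ->
  exists2 y : 'rV[R]_(nparams d W n.+1),
    `|y| <= w n.+1 & `|f - iota (network sigma y)| < e.
Proof.
move=> /(_ n.+1) fn xe.
have : (approx_error iota W sigma f n.+1 (w n.+1) < e%:E)%E.
  by apply: le_lt_trans fn _; rewrite lte_fin.
by rewrite /approx_error => /ereal_inf_ltP[_ [y yw <-]] fy; exists y.
Qed.

(** One [eta] pays for the infimum not being attained, the other for rounding the parameters to the
    grid. *)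
Lemma approx_class_cover (R : realType) (d W : nat) (X : normedModType R)
    (iota : ('cV[R]_d -> R) -> X) (sigma : R -> R) (L : R) :
  continuous_embedding iota -> activation L sigma ->
  exists2 D : R, 1 <= D & forall (xi w : nat -> R) n k (eta : R),
    1 <= w n.+1 -> 0 < eta ->
    D * ((D * w n.+1) ^+ n.+2 * (n.+2%:R * (2 * w n.+1 / 2 ^+ k))) <= eta ->
    exists F : {ffun 'I_(nparams d W n.+1) -> 'I_(2 ^ k)} -> X,
      approx_class iota W sigma xi w `<=`
        \bigcup_t ball (F t) (xi n.+1 + 2 * eta).
Proof.
move=> hiota hsigma.
have [D D1 hD] := embedded_network_dist W hiota hsigma.
exists D => // xi w n k eta w1 eta0 Deta.
have w0 : 0 < w n.+1 by apply: lt_le_trans w1.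
have D0 : 0 <= D by apply: le_trans D1.
have [F [Fw Fy]] := box_grid (nparams d W n.+1) k w0.
exists (fun t => iota (network sigma (F t))) => f fN.
have [|y yw fy] := approx_class_near_network fN (_ : xi n.+1 < xi n.+1 + eta).
  by rewrite ltrDl.
have [t yt] := Fy y yw; exists t => //.
rewrite -ball_normE /= distrC.
rewrite -(subrKA (iota (network sigma y))).
apply: le_lt_trans (ler_normD _ _) _.
suff : `|iota (network sigma y) - iota (network sigma (F t))| <= eta by lra.
apply: le_trans (hD _ _ _ _ w1 yw (Fw t)) (le_trans _ Deta).
rewrite ler_wpM2l // ler_wpM2l ?exprn_ge0 ?mulr_ge0 ?(ltW w0) //.
by rewrite ler_wpM2l.
Qed.

(** * Closedness and compactness *)

(** Every approximation error is 1-Lipschitz in [f], so each defining inequality passes to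
    limits. *)
Lemma approx_class_closed (R : realType) (d W : nat) (X : normedModType R)
    (iota : ('cV[R]_d -> R) -> X) (sigma : R -> R) (xi w : nat -> R) :
  closed (approx_class iota W sigma xi w).
Proof.
move=> f cf n; apply/lee_addgt0Pr => e e0.
have [g [gN fg]] := cf _ (nbhsx_ballx f _ e0).
move: fg; rewrite -ball_normE /= => fg.
case: n => [|n].
  have := gN 0%N; rewrite /= !lee_fin => g0.
  have := ler_normD (f - g) g; rewrite subrK; lra.
(* The part of [e] left over by the distance to [g] is spent on the choice of the network. *)
have e1 : 0 < e - `|f - g| by lra.
have [|y yw gy] := approx_class_near_network gN
  (_ : xi n.+1 < xi n.+1 + (e - `|f - g|)).
  by rewrite ltrDl.
apply: ge_ereal_inf; exists `|f - iota (network sigma y)|%:E; first by exists y.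
rewrite -EFinD lee_fin -(subrKA g); apply: le_trans (ler_normD _ _) _; lra.
Qed.

(* In a complete space a closed totally bounded set is compact: an ultrafilter
   containing it contains a ball of any radius, hence is Cauchy. *)
Lemma totally_bounded_closed_compact (R : realType)
    (X : completeNormedModType R) (K : set X) :
  closed K ->
  (forall e : R, 0 < e ->
    exists (T : finType) (F : T -> X), K `<=` \bigcup_t ball (F t) e) ->
  compact K.
Proof.
move=> Kc Kb; rewrite compact_ultra => F FU FK.
have FP : ProperFilter F by exact: ultra_proper.
have Fc : cauchy F.
  apply: cauchy_exP => e e0; have [T [c Kce]] := Kb e e0.
  apply: contrapT => /forallNP nF.
  (* If [F] contained no ball of radius [e], it would contain the complement of each, hence of their
     finite union, which covers [K]. *)
  have Fn t : F (~` ball (c t) e).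
    by have [/nF|] := in_ultra_setVsetC (ball (c t) e) FU.
  have Fs (s : seq T) : F [set x | forall t, t \in s -> ~ ball (c t) e x].
    elim: s => [|t s IH]; first by apply: filterS filterT => x _ t.
    apply: filterS (filterI (Fn t) IH) => x [xt xs] u.
    by rewrite inE => /orP[/eqP->|/xs].
  have [x [/Kce[t _ xt] /(_ t)]] := filter_ex (filterI FK (Fs (enum T))).
  by rewrite mem_enum => /(_ isT).
have [x Fx] : exists x : X, F --> x by exists (lim F); exact: cauchy_cvg.
exists x; split=> //; apply: Kc => A /Fx FA; exact: (filter_ex (filterI FK FA)).
Qed.

Lemma approx_class_compact (R : realType) (d W : nat)
    (X : completeNormedModType R) (iota : ('cV[R]_d -> R) -> X)
    (sigma : R -> R) (L : R) (xi w : nat -> R) :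
  continuous_embedding iota -> activation L sigma ->
  (forall n, 0 <= xi n) -> inf (range xi) = 0 ->
  (forall n, (1 <= n)%N -> 1 <= w n) ->
  compact (approx_class iota W sigma xi w).
Proof.
move=> hiota hsigma xi0 xiinf w1.
apply: totally_bounded_closed_compact; first exact: approx_class_closed.
move=> e e0; have e3 : 0 < e / 3 by rewrite divr_gt0.
have hinf : has_inf (range xi).
  by split; [exists (xi 0%N); exists 0%N | exists 0 => _ [n _ <-]].
have [_ [n _ <-]] := inf_adherent e3 hinf; rewrite xiinf add0r => xin.
(* At depth 0 the error is the norm itself, so a single ball around 0 covers the class. *)
case: n xin => [|n] xin.
  exists unit, (fun=> 0) => f /(_ 0%N) /=; rewrite lee_fin => f0.
  by exists tt => //; rewrite -ball_normE /= sub0r normrN; lra.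
have [D D1 hD] := approx_class_cover W hiota hsigma.
have wn1 := w1 n.+1 isT.
have D0 : 0 <= D by apply: le_trans D1.
set P := D * ((D * w n.+1) ^+ n.+2 * (n.+2%:R * (2 * w n.+1))).
have w0 : 0 <= w n.+1 by apply: le_trans wn1.
have Dw0 : 0 <= D * w n.+1 by rewrite mulr_ge0.
have P0 : 0 <= P by rewrite mulr_ge0 // (mulr_ge0 (exprn_ge0 _ Dw0)) ?mulr_ge0.
(* Any [k] above the quotient is fine enough, since [k <= 2 ^ k]. *)
set k := (Num.trunc (P / (e / 3))).+1.
have Pk : P / (e / 3) <= 2 ^+ k.
  apply: le_trans (_ : k%:R <= _).
    by have /andP[_ /ltW] := truncn_itv (divr_ge0 P0 (ltW e3)).
  by rewrite -natrX ler_nat ltnW // ltn_expl.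
have [|F hF] := hD xi w n k _ wn1 e3.
  rewrite [leLHS](_ : _ = P / 2 ^+ k); last by rewrite /P -!mulrA.
  by rewrite ler_pdivrMr ?exprn_gt0 // mulrC -ler_pdivrMr.
exists _, F; apply: (subset_trans hF) => f [t _ ft]; exists t => //.
by apply: le_ball ft; lra.
Qed.

(** * Entropy numbers in terms of the depth *)

Lemma entropy_number_le (R : realType) (X : normedModType R) (T : finType)
    (m : nat) (K : set X) (F : T -> X) (e : R) :
  (#|T| <= 2 ^ m)%N -> 0 < e -> K `<=` \bigcup_t ball (F t) e ->
  (entropy_number m K <= e%:E)%E.
Proof.
move=> Tm e0 KF; apply: ereal_inf_lbound; exists e => //; split=> //.
(* The list of centers is padded with 0 up to length [2 ^ m]. *)
exists (fun i => nth 0 (map F (enum T)) i) => f /KF[t _ ft].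
have tT : (index t (enum T) < #|T|)%N by rewrite cardE index_mem mem_enum.
exists (Ordinal (leq_trans tT Tm)) => //=.
by rewrite (nth_map t) -?cardE // nth_index // mem_enum.
Qed.

(** The count is affine in the depth, and its value at depth 2 contains each of the three summands
    once. *)
Lemma nparams_le (d W n : nat) : (0 < n)%N ->
  (nparams d W n <= nparams d W 2 * n)%N.
Proof. by rewrite /nparams; case: n => // n _ /=; rewrite mul1n; nia. Qed.

Lemma ln_le_id (R : realType) (x : R) : 0 <= x -> ln x <= x.
Proof.
rewrite le_eqVlt => /predU1P[<-|x0]; first by rewrite ln0.
have : ln (1 + (x - 1)) <= x - 1 by apply: le_ln1Dx; lra.
by rewrite addrC subrK; lra.
Qed.

(** The covering is used with [eta = xi n], whence the factor 3. A resolution [k] of order [n * g n]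
    suffices, and the number of parameters is of order [n]; the product of the two is the number of
    bits needed. *)
Lemma entropy_number_approx_class (R : realType) (d W : nat)
    (X : normedModType R) (iota : ('cV[R]_d -> R) -> X) (sigma : R -> R)
    (L : R) (xi w g : nat -> R) (a b : R) :
  continuous_embedding iota -> activation L sigma ->
  0 <= a -> 0 <= b ->
  (forall n, (2 <= n)%N -> 1 <= w n /\ ln (w n) <= a * g n) ->
  (forall n, (2 <= n)%N -> 0 < xi n /\ - ln (xi n) <= b * n%:R) ->
  (forall n, (2 <= n)%N -> 1 <= g n) ->
  exists2 D : R, 1 <= D & forall n m, (2 <= n)%N ->
    D * (n%:R ^+ 2 * g n) <= m%:R ->
    (entropy_number m (approx_class iota W sigma xi w) <= (3 * xi n)%:E)%E.
Proof.
move=> hiota hsigma a0 b0 hw hxi hg.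
have [D D1 hD] := approx_class_cover W hiota hsigma.
have D0 : 0 < D by apply: lt_le_trans D1.
have lnD0 : 0 <= ln D by exact: ln_ge0.
have ln20 : 0 < ln 2 :> R by rewrite ln_gt0 // ltr1n.
(* Coefficient of [n * g n] in a bound for [ln S - ln (xi n)], with [S] as below: [ln D] and
   [ln (w n)] enter with total weight [n + 2 <= 3 * n], and [ln (n + 1) + ln 2 <= 4 * n]. *)
set c := 3 * ln D + 3 * a + b + 4.
have c0 : 0 <= c by rewrite /c; lra.
have c20 : 0 <= c / ln 2 by rewrite divr_ge0 // ltW.
set P : R := (nparams d W 2)%:R.
have P1 : 1 <= P by rewrite ler1n /nparams !addn1 !addnS.
(* The first factor bounds [k / (n * g n)], the extra 1 coming from rounding up; [P] bounds the
   number of parameters divided by [n]. *)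
exists ((c / ln 2 + 1) * P).
  by apply: mulr_ege1 => //; rewrite lerDr.
move=> n m n2; have [w1 lnw] := hw n n2; have [xi0 lnxi] := hxi n n2.
have g1 := hg n n2; case: n n2 w1 lnw xi0 lnxi g1 => // n n2 w1 lnw xi0 lnxi g1.
have w0 : 0 < w n.+1 by apply: lt_le_trans w1.
move=> hm; set Q : R := c * (n.+1%:R * g n.+1).
have ng1 : 1 <= n.+1%:R * g n.+1.
  by apply: mulr_ege1 => //; rewrite ler1n.
have Q0 : 0 <= Q / ln 2 
  by rewrite divr_ge0 ?(ltW ln20) // mulr_ge0 // (le_trans ler01).
set k := (Num.trunc (Q / ln 2)).+1.
have /andP[kQ Qk] : k.-1%:R <= Q / ln 2 < k%:R by exact: truncn_itv.
have n20 : 0 < n.+2%:R :> R by [].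
have Dw0 : 0 < (D * w n.+1) ^+ n.+2 by rewrite exprn_gt0 // mulr_gt0.
have w20 : 0 < 2 * w n.+1 by rewrite mulr_gt0.
have nw0 : 0 < n.+2%:R * (2 * w n.+1) by rewrite mulr_gt0.
set S := D * ((D * w n.+1) ^+ n.+2 * (n.+2%:R * (2 * w n.+1))).
have S0 : 0 < S by rewrite mulr_gt0 // mulr_gt0.
have lnS : ln S = ln D + (n.+2%:R * (ln D + ln (w n.+1)) +
    (ln n.+2%:R + (ln 2 + ln (w n.+1)))).
  rewrite lnM ?posrE // ?(mulr_gt0 Dw0) //; congr (_ + _).
  rewrite lnM ?posrE //; congr (_ + _).
    by rewrite lnXn ?mulr_gt0 // lnM ?posrE // mulr_natl.
  by rewrite lnM ?posrE // lnM ?posrE.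
have [|F hF] := hD xi w n k (xi n.+1) w1 xi0.
  rewrite [leLHS](_ : _ = S / 2 ^+ k); last by rewrite /S -!mulrA.
  rewrite ler_pdivrMr ?exprn_gt0 //.
  (* After taking logarithms, each term of [ln S] is compared with [n * g n]. *)
  rewrite -ler_ln ?posrE ?(mulr_gt0 xi0) ?exprn_gt0 //.
  rewrite [in leRHS]lnM ?posrE ?exprn_gt0 // lnXn // -[ln 2 *+ k]mulr_natl lnS.
  rewrite ltr_pdivrMr // in Qk; apply: (le_trans _ (lerD (lexx _) (ltW Qk))).
  rewrite -lerBlDl /Q; set N : R := n.+1%:R in lnxi ng1 *.
  have N2 : 2 <= N by rewrite ler_nat.
  have -> : n.+2%:R = N + 1 :> R by rewrite natr1.
  have lnN : ln (N + 1) <= N + 1 by rewrite ln_le_id //; lra.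
  have ln22 : ln 2 <= 2 :> R by exact: ln_le_id.
  have NG : N <= N * g n.+1 by rewrite ler_peMr //; lra.
  have gG : g n.+1 <= N * g n.+1 by rewrite ler_peMl //; lra.
  have h1 : ln (w n.+1) <= a * (N * g n.+1).
    by apply: le_trans lnw _; rewrite ler_wpM2l.
  have h2 : N * ln (w n.+1) <= a * (N * g n.+1).
    by rewrite mulrCA ler_wpM2l //; lra.
  have h3 : ln D <= ln D * (N * g n.+1) by rewrite ler_peMr.
  have h4 : N * ln D <= ln D * (N * g n.+1) by rewrite mulrC ler_wpM2l.
  have h5 : b * N <= b * (N * g n.+1) by rewrite ler_wpM2l.
  rewrite /c; lra.
have card : (#|{ffun 'I_(nparams d W n.+1) -> 'I_(2 ^ k)}| <= 2 ^ m)%N.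
  rewrite card_ffun !card_ord -expnM leq_exp2l // -(ler_nat R).
  apply: le_trans hm.
  have kc : k%:R <= (c / ln 2 + 1) * (n.+1%:R * g n.+1).
    have -> : k%:R = k.-1%:R + 1 :> R by rewrite natr1.
    rewrite mulrDl mul1r lerD //; apply: le_trans kQ _.
    by rewrite /Q mulrAC.
  have Nn : (nparams d W n.+1)%:R <= P * n.+1%:R.
    by rewrite -natrM ler_nat nparams_le.
  rewrite natrM; apply: le_trans (ler_pM _ _ kc Nn) _ => //.
  by rewrite le_eqVlt; apply/orP; left; apply/eqP; ring.
have e0 : 0 < xi n.+1 + 2 * xi n.+1 by lra.
apply: le_trans (entropy_number_le card e0 hF) _.
by rewrite lee_fin; lra.
Qed.

(** * Choice of the depth and transfer to asymptotic bounds *)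

Lemma natr_powR_near (R : realType) (p x : R) : 0 < p ->
  \forall m \near \oo, x <= (m%:R : R) `^ p.
Proof.
move=> p0; apply: filterS (nbhs_infty_ger (Num.max 0 x `^ p^-1)) => m xm.
apply: le_trans (_ : Num.max 0 x <= _); first by rewrite le_max lexx orbT.
have x0 : 0 <= Num.max 0 x by rewrite le_max lexx.
rewrite -[leLHS]powRr1 // -[X in _ `^ X <= _](mulVf (lt0r_neq0 p0)) powRrM.
by apply: ge0_ler_powR; rewrite ?nnegrE ?powR_ge0 ?(ltW p0).
Qed.

(** The depth is the integer part of [a * t m] with [a = 1 / (D * E)]: then [D * n ^ 2 * g n <= D *
    a ^ 2 * E * m = a * m <= m]. The lower bound on [t] makes [n] large, and [t m <= m] gives
    [n <= m], needed to compare logarithms. *)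
Lemma entropy_scale (R : realType) (A : nat -> \bar R) (xi g t : nat -> R)
    (D E p : R) :
  1 <= D -> 1 <= E -> 0 < p ->
  (forall n m, (2 <= n)%N -> D * (n%:R ^+ 2 * g n) <= m%:R ->
    (A m <= (3 * xi n)%:E)%E) ->
  (forall n, (2 <= n)%N -> 0 <= g n) ->
  (\forall m \near \oo, [/\ m%:R `^ p <= t m, t m <= m%:R &
    forall n, (2 <= n)%N -> n%:R <= t m -> t m ^+ 2 * g n <= E * m%:R]) ->
  exists2 b : R, 0 < b & \forall m \near \oo, exists n,
    [/\ (2 <= n <= m)%N, b * t m <= n%:R & (A m <= (3 * xi n)%:E)%E].
Proof.
move=> D1 E1 p0 hD g0 ht.
have DE1 : 1 <= D * E by exact: mulr_ege1.
have DE0 : 0 < D * E by apply: lt_le_trans DE1.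
pose a := (D * E)^-1.
have a0 : 0 < a by rewrite invr_gt0.
have a1 : a <= 1 by rewrite invf_le1.
exists (a / 2); first by rewrite divr_gt0.
near=> m.
have [pt tm tg] : [/\ m%:R `^ p <= t m, t m <= m%:R &
    forall n, (2 <= n)%N -> n%:R <= t m -> t m ^+ 2 * g n <= E * m%:R].
  by near: m.
(* This gives [n >= 2], and also that the integer part loses at most half of [a * t m]. *)
have at2 : 2 <= a * t m.
  rewrite mulrC -ler_pdivrMr //; apply: le_trans pt.
  by near: m; exact: natr_powR_near.
have t0 : 0 <= t m by rewrite -(pmulr_rge0 _ a0); lra.
have att : a * t m <= t m by rewrite ler_piMl.
pose n := Num.trunc (a * t m).
have /andP[na an] : n%:R <= a * t m < n.+1%:R.
  by apply: truncn_itv; lra.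
have n2 : (2 <= n)%N by rewrite -ltnS -(ltr_nat R); lra.
exists n; split.
- by rewrite n2 -(ler_nat R); lra.
- by rewrite -natr1 in an; lra.
apply: hD => //.
have nt : n%:R <= t m by lra.
have n2at : n%:R ^+ 2 <= a ^+ 2 * t m ^+ 2.
  by rewrite -exprMn lerXn2r // nnegrE; lra.
apply: (@le_trans _ _ (D * (a ^+ 2 * (E * m%:R)))).
  rewrite ler_pM2l; last by lra.
  apply: le_trans (ler_wpM2r (g0 _ n2) n2at) _.
  by rewrite -mulrA ler_pM2l ?exprn_gt0 //; exact: tg.
have -> : D * (a ^+ 2 * (E * m%:R)) = a * m%:R.
  rewrite expr2 (_ : D * _ = a * (D * E) * (a * m%:R)); last by ring.
  by rewrite mulVf ?mul1r // lt0r_neq0.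
by rewrite ler_piMl.
Unshelve. all: by end_near. Qed.

Lemma log2_ge1 (R : realType) (n : nat) : (2 <= n)%N -> 1 <= log2 n%:R :> R.
Proof.
move=> n2; rewrite /log2 ler_pdivlMr ?ln_gt0 ?ltr1n // mul1r.
by rewrite ler_ln ?posrE ?ltr0n ?(ltn_trans _ n2) // ler_nat.
Qed.

(** The sign of [beta] is unknown: the summand 1 serves [beta >= 0] through [x <= y], the summand
    with [q] serves [beta < 0] through [q * y <= x]. *)
Lemma powR_ler_between (R : realType) (q x y beta : R) :
  0 < q -> 0 < y -> q * y <= x -> x <= y ->
  x `^ beta <= (1 + q `^ beta) * y `^ beta.
Proof.
move=> q0 y0 qx xy; have x0 : 0 < x by apply: lt_le_trans qx; rewrite mulr_gt0.
rewrite mulrDl mul1r -powRM ?(ltW q0) ?(ltW y0) //.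
have [b0|b0] := lerP 0 beta.
  apply: ler_wpDr; first exact: powR_ge0.
  by apply: ge0_ler_powR; rewrite ?nnegrE ?(ltW x0) ?(ltW y0).
apply: ler_wpDl; first exact: powR_ge0.
rewrite -[beta]opprK ![_ `^ - - beta]powRN.
rewrite lef_pV2 ?posrE ?powR_gt0 ?mulr_gt0 //.
by apply: ge0_ler_powR;
  rewrite ?nnegrE ?oppr_ge0 ?(ltW b0) ?mulr_ge0 ?(ltW x0) ?(ltW y0) ?(ltW q0).
Qed.

Lemma asymp_le_poly (R : realType) (A : nat -> \bar R) (xi t : nat -> R)
    (C alpha beta b p : R) :
  0 < C -> 0 < alpha -> 0 < b -> 0 < p ->
  (forall n, (2 <= n)%N ->
    xi n = C * log2 n%:R `^ beta * n%:R `^ (- alpha)) ->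
  (\forall m \near \oo, m%:R `^ p <= t m) ->
  (\forall m \near \oo, exists n,
    [/\ (2 <= n <= m)%N, b * t m <= n%:R & (A m <= (3 * xi n)%:E)%E]) ->
  asymp_le A (fun m => t m `^ (- alpha) * log2 m%:R `^ beta).
Proof.
move=> C0 alpha0 b0 p0 hxi pt hA.
exists (3 * (C * (1 + (p / 2) `^ beta) * b `^ (- alpha))).
  by rewrite !mulr_gt0 ?powR_gt0 // ltr_wpDr ?powR_ge0.
near=> m.
have [n [/andP[n2 nm] tn hAm]] : exists n,
    [/\ (2 <= n <= m)%N, b * t m <= n%:R & (A m <= (3 * xi n)%:E)%E].
  by near: m.
have ptm : m%:R `^ p <= t m by near: m.
(* Half of the exponent [p] absorbs the factor [b], so [n] lies between the power [p / 2] of [m] and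
   [m], and [log2 n] is comparable to [log2 m]. *)
have bm : b^-1 <= m%:R `^ (p / 2).
  by near: m; apply: natr_powR_near; rewrite divr_gt0.
have m2 : (2 <= m)%N by exact: leq_trans nm.
have n0 : 0 < n%:R :> R by rewrite ltr0n (ltn_trans _ n2).
have m0 : 0 < m%:R :> R by rewrite ltr0n (ltn_trans _ m2).
have t0 : 0 < t m by apply: lt_le_trans ptm; rewrite powR_gt0.
have ln20 : 0 < ln 2 :> R by rewrite ln_gt0 // ltr1n.
apply: le_trans hAm _; rewrite lee_fin -!mulrA ler_pM2l // hxi // -!mulrA.
rewrite ler_pM2l //.
have mn : m%:R `^ (p / 2) <= n%:R.
  apply: le_trans tn; apply: le_trans (ler_wpM2l (ltW b0) ptm).
  rewrite [in leRHS](splitr p) powRD ?(gt_eqF m0) ?implybT // mulrA.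
  by rewrite ler_peMl ?powR_ge0 // mulrC -ler_pdivrMr // div1r.
have hlog : log2 n%:R `^ beta <= (1 + (p / 2) `^ beta) * log2 m%:R `^ beta :> R.
  apply: powR_ler_between; first by rewrite divr_gt0.
  - exact: lt_le_trans (log2_ge1 _ m2).
  - rewrite /log2 mulrA ler_pM2r ?invr_gt0 // -ln_powR.
    by rewrite ler_ln ?posrE ?powR_gt0.
  - by rewrite /log2 ler_pM2r ?invr_gt0 // ler_ln ?posrE // ler_nat.
have hn : n%:R `^ (- alpha) <= b `^ (- alpha) * t m `^ (- alpha).
  rewrite -powRM ?(ltW b0) ?(ltW t0) // !powRN.
  rewrite lef_pV2 ?posrE ?powR_gt0 ?mulr_gt0 //.
  apply: ge0_ler_powR;
    rewrite ?nnegrE ?(ltW alpha0) // ?mulr_ge0 ?(ltW t0) ?(ltW b0) //.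
apply: le_trans (ler_pM (powR_ge0 _ _) (powR_ge0 _ _) hlog hn) _.
by rewrite le_eqVlt; apply/orP; left; apply/eqP; ring.
Unshelve. all: by end_near. Qed.

(** Here the factor [b] in the depth cannot be moved into the constant of the estimate; it stays in
    the exponent. *)
Lemma asymp_le_exp (R : realType) (A : nat -> \bar R) (xi t : nat -> R)
    (C c b : R) :
  0 < C -> 0 < c ->
  (forall n, xi n = C * 2 `^ (- (c * n%:R))) ->
  (\forall m \near \oo, exists n,
    [/\ (2 <= n <= m)%N, b * t m <= n%:R & (A m <= (3 * xi n)%:E)%E]) ->
  asymp_le A (fun m => 2 `^ (- (c * b * t m))).
Proof.
move=> C0 c0 hxi hA; exists (3 * C); first by rewrite mulr_gt0.
apply: filterS hA => m [n [_ tn /le_trans]]; apply.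
rewrite lee_fin hxi mulrA ler_pM2l ?mulr_gt0 // ler_powR ?ler1n //.
by rewrite lerN2 -mulrA ler_pM2l.
Qed.

Lemma ln2_gt0 (R : realType) : 0 < ln 2 :> R.
Proof. by rewrite ln_gt0 // ltr1n. Qed.

Lemma ln2_le1 (R : realType) : ln 2 <= 1 :> R.
Proof.
have : ln (1 + 1) <= 1 :> R by apply: le_ln1Dx; lra.
by rewrite -[1 + 1]/(2 : R).
Qed.

Lemma asymp_le_near_eq (R : realType) (A : nat -> \bar R) (B B' : nat -> R) :
  asymp_le A B -> (\forall m \near \oo, B m = B' m) -> asymp_le A B'.
Proof.
move=> [k k0 hA] hB; exists k => //.
by apply: filterS (filterI hA hB) => m [hm <-].
Qed.

(** Here [t m ^+ 2 = m / log2 m], while [n <= t m <= m] gives [1 + ln n <= 2 * log2 m]. The lower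
    bound amounts to [log2 m <= sqrt m] for large [m]. *)
Lemma sqrt_log_scale (R : realType) :
  let t (m : nat) : R := Num.sqrt m%:R / Num.sqrt (log2 m%:R) in
  \forall m \near \oo, [/\ m%:R `^ (1 / 4) <= t m, t m <= m%:R &
    forall n, (2 <= n)%N -> n%:R <= t m ->
      t m ^+ 2 * (1 + ln n%:R) <= 2 * m%:R].
Proof.
move=> t.
have ln20 := ln2_gt0 R.
have ln21 := ln2_le1 R.
near=> m.
have m2 : (2 <= m)%N by near: m; exact: nbhs_infty_ge.
have m0 : 0 < m%:R :> R by rewrite ltr0n (ltn_trans _ m2).
have m1 : 1 <= m%:R :> R by rewrite ler1n (ltn_trans _ m2).
have l1 : 1 <= log2 m%:R :> R by exact: log2_ge1.
have l0 : 0 < log2 m%:R :> R by apply: lt_le_trans l1.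
have sl1 : 1 <= Num.sqrt (log2 m%:R) :> R by rewrite -[leLHS]sqrtr1 ler_wsqrtr.
have sl0 : 0 < Num.sqrt (log2 m%:R) :> R by rewrite sqrtr_gt0.
have sm1 : 1 <= Num.sqrt m%:R :> R by rewrite -[leLHS]sqrtr1 ler_wsqrtr.
have tm : t m <= m%:R.
  rewrite ler_pdivrMr // -[X in X <= _]mulr1; apply: ler_pM => //.
  by rewrite -[leRHS]sqr_sqrtr ?ler0n // expr2 ler_peMl // sqrtr_ge0.
have t2 : t m ^+ 2 = m%:R / log2 m%:R.
  by rewrite expr_div_n !sqr_sqrtr ?(ltW l0).
split=> //.
  set x : R := m%:R `^ (1 / 4).
  have x0 : 0 < x by rewrite powR_gt0.
  have xx : x ^+ 2 = Num.sqrt m%:R.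
    rewrite -powR12_sqrt ?ler0n // -powR_mulrn ?(ltW x0) // -powRrM.
    by congr (_ `^ _); field.
  (* From [ln x <= x] follows [ln m <= 4 * x], so this threshold yields [log2 m <= x ^+ 2]. *)
  have x4 : 4 / ln 2 <= x.
    by rewrite /x; near: m; apply: natr_powR_near; lra.
  have lm : log2 m%:R <= x ^+ 2.
    have : ln x <= x by apply: ln_le_id; exact: ltW.
    rewrite /x ln_powR -/x => lx.
    rewrite /log2 ler_pdivrMr //; rewrite ler_pdivrMr // in x4.
    have : 4 * x <= x * ln 2 * x by rewrite ler_pM2r.
    by rewrite expr2; lra.
  rewrite ler_pdivlMr // -xx expr2 ler_pM2l //.
  by rewrite -[leRHS]ger0_norm ?(ltW x0) // -sqrtr_sqr ler_wsqrtr.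
move=> n n2 nt.
rewrite t2 mulrAC ler_pdivrMr // [2 * _]mulrC -mulrA ler_pM2l //.
have n0 : 0 < n%:R :> R by rewrite ltr0n (ltn_trans _ n2).
have lnm : ln n%:R <= ln m%:R :> R by rewrite ler_ln ?posrE //; lra.
have : ln m%:R <= log2 m%:R :> R.
  rewrite /log2 ler_pdivlMr // ler_piMr // ln_ge0 //.
by lra.
Unshelve. all: by end_near. Qed.

(** The scale solves [t ^ (nu + 2) = m], and [n <= t m] bounds the power [nu] of [n] by that of
    [t m]. *)
Lemma powR_scale (R : realType) (nu : R) : 0 <= nu ->
  let t (m : nat) : R := m%:R `^ (1 / (nu + 2)) in
  \forall m \near \oo, [/\ m%:R `^ (1 / (nu + 2)) <= t m, t m <= m%:R &
    forall n, (2 <= n)%N -> n%:R <= t m ->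
      t m ^+ 2 * n%:R `^ nu <= 1 * m%:R].
Proof.
move=> nu0 t; apply: filterS (nbhs_infty_ge 1) => m /= m1.
have nu2 : 0 < nu + 2 by lra.
have m1' : 1 <= m%:R :> R by rewrite ler1n.
split=> // [|n n2 nt].
  rewrite -[leRHS]powRr1 ?ler0n // ler_powR // ler_pdivrMr // mul1r; lra.
have t0 : 0 < t m by rewrite powR_gt0 // ltr0n.
rewrite mul1r; apply: le_trans (_ : t m ^+ 2 * t m `^ nu <= _).
  by rewrite ler_wpM2l ?exprn_ge0 ?(ltW t0) // ge0_ler_powR ?nnegrE ?(ltW t0).
rewrite -powR_mulrn ?(ltW t0) // -powRD ?(gt_eqF t0) ?implybT //.
by rewrite /t -powRrM [2%:R + nu]addrC div1r mulVf ?lt0r_neq0 // powRr1.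
Qed.

(** * The concrete accuracies and weights *)

(** The true growth is logarithmic; a linear bound suffices because the resolution is of order at
    least [n] anyway. The term with [beta] uses [ln (log2 n) <= log2 n <= n / ln 2]. *)
Lemma poly_log_rate (R : realType) (C alpha beta : R) (xi : nat -> R) :
  0 < C -> 0 < alpha ->
  (forall n, (2 <= n)%N ->
    xi n = C * log2 n%:R `^ beta * n%:R `^ (- alpha)) ->
  forall n, (2 <= n)%N -> 0 < xi n /\
    - ln (xi n) <= (`|ln C| + `|beta| / ln 2 + alpha) * n%:R.
Proof.
move=> C0 alpha0 hxi n n2; rewrite hxi //.
have ln20 := ln2_gt0 R.
have n0 : 0 < n%:R :> R by rewrite ltr0n (ltn_trans _ n2).
have n1 : 1 <= n%:R :> R by rewrite ler1n (ltn_trans _ n2).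
have l1 := log2_ge1 R n2; have l0 : 0 < log2 n%:R :> R by apply: lt_le_trans l1.
split; first by rewrite !mulr_gt0 ?powR_gt0.
rewrite !lnM ?posrE ?mulr_gt0 ?powR_gt0 // !ln_powR.
have lnn : ln n%:R <= n%:R :> R by exact: ln_le_id.
have hC : - ln C <= `|ln C| * n%:R.
  by apply: le_trans (ler_norm _) _; rewrite normrN ler_peMr.
have hb : - (beta * ln (log2 n%:R)) <= `|beta| / ln 2 * n%:R.
  rewrite -mulNr; apply: le_trans (ler_norm _) _.
  rewrite normrM normrN -mulrA ler_wpM2l //.
  rewrite ger0_norm ?ln_ge0 //; apply: le_trans (ln_le_id (ltW l0)) _.
  by rewrite /log2 mulrC ler_wpM2l // invr_ge0 ltW.
have ha : alpha * ln n%:R <= alpha * n%:R by rewrite ler_pM2l.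
lra.
Qed.

Lemma exp_rate (R : realType) (C c : R) (xi : nat -> R) :
  0 < C -> 0 < c -> (forall n, xi n = C * 2 `^ (- (c * n%:R))) ->
  forall n, (2 <= n)%N -> 0 < xi n /\ - ln (xi n) <= (`|ln C| + c) * n%:R.
Proof.
move=> C0 c0 hxi n n2; rewrite hxi.
have n1 : 1 <= n%:R :> R by rewrite ler1n (ltn_trans _ n2).
split; first by rewrite mulr_gt0 ?powR_gt0.
rewrite lnM ?posrE ?powR_gt0 // ln_powR.
have ln21 := ln2_le1 R.
have hC : - ln C <= `|ln C| * n%:R.
  by apply: le_trans (ler_norm _) _; rewrite normrN ler_peMr.
have hc : c * n%:R * ln 2 <= c * n%:R by rewrite ler_piMr // mulr_ge0 // ltW.
lra.
Qed.

(** Here [ln (w n) = ln C + delta * ln n], dominated by a multiple of [g n = 1 + ln n]; the 1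
    absorbs [ln C] and ensures [g n >= 1]. *)
Lemma entropy_polynomial_weights (R : realType) (d W : nat)
    (X : normedModType R) (iota : ('cV[R]_d -> R) -> X) (sigma : R -> R)
    (L C delta b : R) (xi : nat -> R) :
  let w n := C * n%:R `^ delta in
  let t (m : nat) : R := Num.sqrt m%:R / Num.sqrt (log2 m%:R) in
  continuous_embedding iota -> activation L sigma ->
  0 < C -> 0 < delta -> 0 <= b -> admissible_bound L W w ->
  (forall n, (2 <= n)%N -> 0 < xi n /\ - ln (xi n) <= b * n%:R) ->
  exists2 b : R, 0 < b & \forall m \near \oo, exists n,
    [/\ (2 <= n <= m)%N, b * t m <= n%:R &
      (entropy_number m (approx_class iota W sigma xi w) <= (3 * xi n)%:E)%E].
Proof.
move=> w t hiota hsigma C0 delta0 b0 hw hxi.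
have ln1 n : (2 <= n)%N -> 0 <= ln n%:R :> R.
  by move=> n2; rewrite ln_ge0 // ler1n (ltn_trans _ n2).
have [|n n2|n n2|D D1 hD] := entropy_number_approx_class
  (w := w) (g := fun n => 1 + ln n%:R) (a := `|ln C| + delta)
  W hiota hsigma _ b0 _ hxi.
- by rewrite addr_ge0 // ltW.
- have n0 : 0 < n%:R :> R by rewrite ltr0n (ltn_trans _ n2).
  split; first by have [] := hw n (ltn_trans _ n2).
  rewrite /w lnM ?posrE ?powR_gt0 // ln_powR mulrDr mulr1 mulrDl.
  have := mulr_ge0 (normr_ge0 (ln C)) (ln1 n n2); have := ler_norm (ln C); lra.
- by rewrite lerDl ln1.
apply: (entropy_scale (g := fun n => 1 + ln n%:R) (p := 1 / 4) D1 _ _ hD _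
  (sqrt_log_scale R)) => [||n n2]; [by rewrite ler1n|lra|].
by rewrite addr_ge0 // ln1.
Qed.

(** Here [ln (w n)] is [ln C] plus [c * ln 2] times the power [nu] of [n]. That power is at least 1
    as [nu >= 0], so it absorbs [ln C] and serves as [g]. *)
Lemma entropy_exponential_weights (R : realType) (d W : nat)
    (X : normedModType R) (iota : ('cV[R]_d -> R) -> X) (sigma : R -> R)
    (L C c nu b : R) (xi : nat -> R) :
  let w n := C * 2 `^ (c * n%:R `^ nu) in
  continuous_embedding iota -> activation L sigma ->
  0 < C -> 0 < c -> 0 <= nu -> 0 <= b -> admissible_bound L W w ->
  (forall n, (2 <= n)%N -> 0 < xi n /\ - ln (xi n) <= b * n%:R) ->
  exists2 b : R, 0 < b & \forall m \near \oo, exists n,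
    [/\ (2 <= n <= m)%N, b * m%:R `^ (1 / (nu + 2)) <= n%:R &
      (entropy_number m (approx_class iota W sigma xi w) <= (3 * xi n)%:E)%E].
Proof.
move=> w hiota hsigma C0 c0 nu0 b0 hw hxi.
have n_ge1 n : (2 <= n)%N -> 1 <= n%:R `^ nu :> R.
  move=> n2; rewrite -[leLHS](powRr0 n%:R) ler_powR // ler1n.
  exact: ltn_trans n2.
have [|n n2|n n2|D D1 hD] := entropy_number_approx_class
  (w := w) (g := fun n => n%:R `^ nu) (a := `|ln C| + c)
  W hiota hsigma _ b0 _ hxi.
- by rewrite addr_ge0 // ltW.
- have n0 : 0 < n%:R :> R by rewrite ltr0n (ltn_trans _ n2).
  split; first by have [] := hw n (ltn_trans _ n2).
  rewrite /w lnM ?posrE ?powR_gt0 // ln_powR mulrDl lerD //.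
    by rewrite (le_trans (ler_norm _)) // ler_peMr // n_ge1.
  by rewrite ler_piMr ?ln2_le1 // mulr_ge0 ?powR_ge0 // ltW.
- exact: n_ge1.
apply: (entropy_scale (g := fun n => n%:R `^ nu) D1 (lexx 1) _ hD _
  (powR_scale nu0)) => [|n _]; last exact: powR_ge0.
by rewrite divr_gt0 //; lra.
Qed.

Theorem corollary6p5 (R : realType) (d W : nat) (X : completeNormedModType R)
    (iota : ('cV[R]_d -> R) -> X) (sigma : R -> R) (L : R)
    (C C' c c' alpha delta nu beta : R)
    (hd : (1 <= d)%N) (hW : (2 <= W)%N)
    (hiota : continuous_embedding iota) (hsigma : activation L sigma)
    (hC : 0 < C) (hC' : 0 < C') (hc : 0 < c) (hc' : 0 < c')
    (halpha : 0 < alpha) (hdelta : 0 < delta) (hnu : 0 <= nu) :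
  let w1 : nat -> R := fun n => C * n%:R `^ delta in
  let w2 : nat -> R := fun n => C * 2 `^ (c' * n%:R `^ nu) in
  let N : (nat -> R) -> (nat -> R) -> set X := approx_class iota W sigma in
  [/\ forall xi w : nat -> R,
        (forall n, 0 <= xi n) -> inf (range xi) = 0 ->
        admissible_bound L W w -> compact (N xi w),
      forall xi : nat -> R,
        (forall n, 0 <= xi n) ->
        (forall n, (2 <= n)%N ->
          xi n = C' * log2 n%:R `^ beta * n%:R `^ (- alpha)) ->
        (admissible_bound L W w1 ->
          asymp_le (fun n => entropy_number n (N xi w1))
            (fun n => n%:R `^ (- (alpha / 2)) *
                      log2 n%:R `^ (beta + alpha / 2))) /\
        (admissible_bound L W w2 ->
          asymp_le (fun n => entropy_number n (N xi w2))
            (fun n => n%:R `^ (- (alpha / (nu + 2))) * log2 n%:R `^ beta))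
    & forall xi : nat -> R,
        (forall n, xi n = C' * 2 `^ (- (c * n%:R))) ->
        (admissible_bound L W w1 ->
          exists2 c1 : R, 0 < c1 &
            asymp_le (fun n => entropy_number n (N xi w1))
              (fun n => 2 `^ (- (c1 * Num.sqrt n%:R
                                  / Num.sqrt (log2 n%:R))))) /\
        (admissible_bound L W w2 ->
          exists2 c1 : R, 0 < c1 &
            asymp_le (fun n => entropy_number n (N xi w2))
              (fun n => 2 `^ (- (c1 * n%:R `^ (1 / (nu + 2))))))].
Proof.
move=> w1 w2 N; split.
- move=> xi w xi0 xiinf hw.
  apply: (approx_class_compact hiota hsigma) => // n n1.
  by have [] := hw n n1.
- move=> xi xi0 hxi; have hr := poly_log_rate hC' halpha hxi.
  have b0 : 0 <= `|ln C'| + `|beta| / ln 2 + alpha.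
    by rewrite !addr_ge0 ?divr_ge0 ?(ltW halpha) ?(ltW (ln2_gt0 R)).
  split=> hw.
    have [b b0' hA] :=
      entropy_polynomial_weights hiota hsigma hC hdelta b0 hw hr.
    have p0 : 0 < 1 / 4 :> R by lra.
    apply: asymp_le_near_eq (asymp_le_poly hC' halpha b0' p0 hxi _ hA) _.
      by apply: filterS (sqrt_log_scale R) => m [].
    (* The denominator of [t m] contributes the power [alpha / 2] of [log2 m], which merges with the
       power [beta] once [log2 m > 0]. *)
    apply: filterS (nbhs_infty_ge 2) => m /= m2.
    have l0 : 0 < log2 m%:R :> R by apply: lt_le_trans (log2_ge1 R m2).
    rewrite -!powR12_sqrt ?ler0n ?(ltW l0) // -powRN.
    rewrite powRM ?powR_ge0 // -!powRrM -mulrA -powRD; last first.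
      by rewrite (gt_eqF l0) implybT.
    by congr (_ `^ _ * _ `^ _); field.
  have [b b0' hA] :=
    entropy_exponential_weights hiota hsigma hC hc' hnu b0 hw hr.
  have p0 : 0 < 1 / (nu + 2) by rewrite divr_gt0 //; lra.
  apply: asymp_le_near_eq (asymp_le_poly hC' halpha b0' p0 hxi _ hA) _.
    by apply: filterS (powR_scale hnu) => m [].
  apply: nearW => m; rewrite -powRrM; congr (_ `^ _ * _).
  by field; lra.
- move=> xi hxi; have hr := exp_rate hC' hc hxi.
  have b0 : 0 <= `|ln C'| + c by rewrite addr_ge0 // ltW.
  split=> hw.
    have [b b0' hA] :=
      entropy_polynomial_weights hiota hsigma hC hdelta b0 hw hr.
    exists (c * b); first exact: mulr_gt0.
    apply: asymp_le_near_eq (asymp_le_exp hC' hc hxi hA) _.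
    by apply: nearW => m; rewrite !mulrA.
  have [b b0' hA] :=
    entropy_exponential_weights hiota hsigma hC hc' hnu b0 hw hr.
  exists (c * b); first exact: mulr_gt0.
  exact: asymp_le_exp hC' hc hxi hA.
Qed.
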